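(* Let $\omega$ be a nonempty factor of $D_\infty$ and let $\mathrm{Env}(\omega)=E_{m,i}$ with $m\ge1$, $i\in\{1,2\}$. (1) If $i=1$, the gap sequence of $\omega$ is the sequence $\Theta_1$ on the alphabet $\{G_1(\omega),G_2(\omega)\}$; that is, for all $p\ge1$, $G_p(\omega)=G_1(\omega)$ if $\Theta_1[p]=a$ and $G_p(\omega)=G_2(\omega)$ if $\Theta_1[p]=b$. (2) If $i=2$, the gap sequence of $\omega$ is the sequence $\Theta_2$ on the alphabet $\{G_1(\omega),G_2(\omega),G_4(\omega)\}$; that is, for all $p\ge1$, $G_p(\omega)$ equals $G_1(\omega)$, $G_2(\omega)$ or $G_4(\omega)$ according as $\Theta_2[p]$ is $a$, $b$ or $c$.
   Context: Let $\sigma$ be the morphism on $\{a,b\}^*$ with $\sigma(a)=ab$, $\sigma(b)=aa$. The Doubling sequence is $D_\infty=x_1x_2x_3\cdots=\sigma^\infty(a)=abaaabab\cdots$, the infinite fixed point of $\sigma$ beginning with $a$. Put $A_m=\sigma^m(a)$ for $m\ge0$ and let $\delta_m$ be the last letter of $A_m$. Inverses of words are taken in the free group on $\{a,b\}$; $\varepsilon$ is the empty word. $u\prec v$ means that $u$ is a factor of $v$. For $m\ge1$ the envelope words are $E_{m,1}=A_m\delta_m^{-1}$ (i.e. $A_m$ with its last letter removed) and $E_{m,2}=A_{m-1}A_m\delta_m^{-1}$. They are ordered by: $E_{m_1,i_1}\sqsubset E_{m_2,i_2}$ iff $m_1<m_2$, or $m_1=m_2$ and $i_1<i_2$. For a factor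 $\omega$ of $D_\infty$, $\mathrm{Env}(\omega)$ is the minimal envelope word (under $\sqsubset$) having $\omega$ as a factor. Every factor $\omega$ of $D_\infty$ occurs infinitely often; $\omega_p$ ($p\ge1$) denotes its $p$-th occurrence, occurrences (overlaps allowed) being ordered by starting position. If $|\omega|=n$, $\omega_p=x_{i+1}\cdots x_{i+n}$ and $\omega_{p+1}=x_{j+1}\cdots x_{j+n}$, the gap $G_p(\omega)$ is $\varepsilon$ if $i+n=j$; $x_{i+n+1}\cdots x_j$ if $i+n<j$; and $(x_{j+1}\cdots x_{i+n})^{-1}$ if $i+n>j$. The gap sequence of $\omega$ is $\{G_p(\omega)\}_{p\ge1}$. Let $\varphi_1(a)=a$, $\varphi_1(b)=bb$ and $\varphi_2(a)=ab$, $\varphi_2(b)=acac$, extended to infinite words by concatenation; $\Theta_1=\varphi_1(D_\infty)$ and $\Theta_2=\varphi_2(D_\infty)$. $\Theta_j[p]$ is the $p$-th letter of $\Theta_j$. *)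

(* Defs.v *)
From HB Require Import structures.
From mathcomp Require Import all_boot.
From mathcomp Require Import zify.

Set Implicit Arguments.
Unset Strict Implicit.
Unset Printing Implicit Defensive.

Inductive letter := La | Lb.

Definition bool_of_letter (x : letter) : bool := if x is La then false else true.
Definition letter_of_bool (c : bool) : letter := if c then Lb else La.
Lemma bool_of_letterK : cancel bool_of_letter letter_of_bool.
Proof. by case. Qed.
HB.instance Definition _ := Choice.copy letter (can_type bool_of_letterK).

Inductive letter3 := Ta | Tb | Tc.

Definition morph (S T : Type) (f : S -> seq T) (s : seq S) : seq T :=
  flatten (map f s).

(* Infinite words are functions on nat, indexed from 0: the p-th letter (p >= 1)
   of x is x p.-1. The default d is never used when all images f s are nonempty,
   since the image of the first n+1 letters then has length at least n+1. *)
Definition inf_image (S T : Type) (d : T) (f : S -> seq T) (x : nat -> S)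
    (n : nat) : T :=
  nth d (morph f (mkseq x n.+1)) n.

Definition sigma (x : letter) : seq letter :=
  match x with La => [:: La; Lb] | Lb => [:: La; La] end.

Definition A (m : nat) : seq letter := iter m (morph sigma) [:: La].

(* The A m are prefixes of each other (lemma A_prefix) and size (A n) = 2 ^ n
   exceeds n, so the default value is never used. *)
Definition Dinf (n : nat) : letter := nth La (A n) n.

(* x_{i+1} ... x_{i+n} *)
Definition subword (i n : nat) : seq letter := [seq Dinf k | k <- iota i n].

Definition occ (w : seq letter) (i : nat) : bool := subword i (size w) == w.

Definition factorD (w : seq letter) : Prop := exists i, occ w i.

Lemma morph_cat (S T : Type) (f : S -> seq T) (s t : seq S) :
  morph f (s ++ t) = morph f s ++ morph f t.
Proof. by rewrite /morph map_cat flatten_cat. Qed.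

Lemma iter_morph_cat (T : Type) (f : T -> seq T) m (s t : seq T) :
  iter m (morph f) (s ++ t) = iter m (morph f) s ++ iter m (morph f) t.
Proof. by elim: m => //= m ->; rewrite morph_cat. Qed.

Lemma size_morph_sigma s : size (morph sigma s) = (size s).*2.
Proof. by elim: s => //= x s IH; rewrite size_cat IH doubleS; case: x. Qed.

Lemma size_A m : size (A m) = 2 ^ m.
Proof.
elim: m => // m IH.
by rewrite /A iterS size_morph_sigma -/(A m) IH expnS mul2n.
Qed.

Lemma A_prefix m k : exists t, A (m + k) = A m ++ t.
Proof.
elim: k => [|k [t IH]]; first by exists [::]; rewrite addn0 cats0.
exists (iter m (morph sigma) (behead (A k.+1))).
rewrite /A iterD -iter_morph_cat; congr (iter m _ _).
have: size (A k.+1) = 2 ^ k.+1 by exact: size_A.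
have: nth La (A k.+1) 0 = La.
  by rewrite /A iterS; case: (iter k _ _) => // -[].
by rewrite /A; case: (iter k.+1 _ _) => [|x s] /= => [_|->] //; lia.
Qed.

Lemma Dinf_prefix m n : n < 2 ^ m -> Dinf n = nth La (A m) n.
Proof.
move=> lt_n; have lt_nn : n < 2 ^ n by exact: ltn_expl.
rewrite /Dinf; case: (leqP n m) => [le_nm|/ltnW le_mn].
  have [t] := A_prefix n (m - n); rewrite subnKC // => ->.
  by rewrite nth_cat size_A lt_nn.
have [t] := A_prefix m (n - m); rewrite subnKC // => ->.
by rewrite nth_cat size_A lt_n.
Qed.

Lemma nth_morph_sigma s n : n < size s ->
  nth La (morph sigma s) n.*2 = La /\
  nth La (morph sigma s) n.*2.+1 = nth La (sigma (nth La s n)) 1.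
Proof.
elim: s n => // x s IH [|n] /= lt_n; first by case: x {lt_n}.
by have := IH n lt_n; case: x {lt_n}.
Qed.

Lemma Dinf_double n :
  Dinf n.*2 = La /\ Dinf n.*2.+1 = nth La (sigma (Dinf n)) 1.
Proof.
have lt_n : n < 2 ^ n by exact: ltn_expl.
have lt_n2 : n.*2.+1 < 2 ^ n.+1 by rewrite expnS; lia.
rewrite (Dinf_prefix lt_n2) (Dinf_prefix (ltnW lt_n2)) (Dinf_prefix lt_n).
by rewrite /A iterS; apply: nth_morph_sigma; rewrite -/(A n) size_A.
Qed.

Lemma Dinf_fixed : inf_image La sigma Dinf =1 Dinf.
Proof.
move=> n; rewrite /inf_image.
have lt_n : n./2 < size (mkseq Dinf n.+1) by rewrite size_mkseq; lia.
have [E0 E1] := nth_morph_sigma lt_n.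
have [D0 D1] := Dinf_double n./2.
rewrite nth_mkseq in E1; last by lia.
rewrite -{2 3}(odd_double_half n); case: (odd n); rewrite ?add1n ?add0n.
  by rewrite E1 D1.
by rewrite E0 D0.
Qed.

Lemma Dinf_period m N r : r < 2 ^ m -> Dinf (N * 2 ^ m.+1 + r) = Dinf r.
Proof.
elim: m r => [|m IH] r lt_r.
  have ->: r = 0 by move: lt_r; rewrite expn0; lia.
  by rewrite addn0 expn1 muln2; case: (Dinf_double N) => ->.
have lt_r2 : r./2 < 2 ^ m by move: lt_r; rewrite expnS; lia.
have [D0 D1] := Dinf_double r./2.
have [F0 F1] := Dinf_double (N * 2 ^ m.+1 + r./2).
rewrite -{1 2}(odd_double_half r).
rewrite [X in Dinf X](_ : _ = odd r + (N * 2 ^ m.+1 + r./2).*2); last first.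
  by rewrite [2 ^ m.+2]expnS doubleD -!mul2n; lia.
by case: (odd r); rewrite ?add1n ?add0n ?D0 ?D1 ?F0 ?F1 ?IH.
Qed.

Lemma occ_unbounded w : factorD w -> forall N, exists j, (N <= j) && occ w j.
Proof.
move=> [i /eqP occ_i] N; pose m := i + size w.
have lt_m : m < 2 ^ m by exact: ltn_expl.
exists (N * 2 ^ m.+1 + i); apply/andP; split.
  by apply: leq_trans (leq_addr _ _); apply: leq_pmulr; rewrite expn_gt0.
rewrite /occ -[eqbRHS]occ_i /subword iotaDl -map_comp; apply/eqP.
apply/eq_in_map => k; rewrite mem_iota /= => /andP[_ lt_k].
by rewrite Dinf_period //; apply: ltn_trans lt_k lt_m.
Qed.

Definition next_occ w (hw : factorD w) (N : nat) : nat :=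
  ex_minn (occ_unbounded hw N).

(* The p-th occurrence (p >= 1) is x_{i+1} ... x_{i+n} with i = occ_pos hw p. *)
Definition occ_pos w (hw : factorD w) (p : nat) : nat :=
  iter p.-1 (fun i => next_occ hw i.+1) (next_occ hw 0).

Lemma next_occP w (hw : factorD w) N :
  [/\ N <= next_occ hw N, occ w (next_occ hw N)
    & forall j, N <= j -> occ w j -> next_occ hw N <= j].
Proof.
rewrite /next_occ; case: ex_minnP => i /andP[le_i occ_i] min_i; split=> // j le_j.
by move=> occ_j; apply: min_i; rewrite le_j.
Qed.

Lemma occ_pos_occ w (hw : factorD w) p : occ w (occ_pos hw p).
Proof.
have H N : occ w (next_occ hw N) by case: (next_occP hw N).
by rewrite /occ_pos; case: p.-1 => [|q]; apply: H.
Qed.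

Lemma occ_pos_lt w (hw : factorD w) p : 0 < p -> occ_pos hw p < occ_pos hw p.+1.
Proof.
by case: p => // p _; case: (next_occP hw (occ_pos hw p.+1).+1).
Qed.

Lemma occ_pos_surj w (hw : factorD w) i :
  occ w i -> exists2 p, 0 < p & occ_pos hw p = i.
Proof.
move=> occ_i.
have H p : occ_pos hw p.+1 <= i \/ exists2 q, 0 < q & occ_pos hw q = i.
  elim: p => [|p [le_i|]]; last by right.
    by left; case: (next_occP hw 0) => _ _; apply.
  move: le_i; rewrite leq_eqVlt => /predU1P[<-|lt_i]; first by right; exists p.+1.
  by left; case: (next_occP hw (occ_pos hw p.+1).+1) => _ _; apply.
have big p : p <= occ_pos hw p.+1.
  by elim: p => // p IH; apply: leq_ltn_trans IH (occ_pos_lt hw (ltn0Sn p)).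
by case: (H i.+1) => // /(leq_trans (big _)); rewrite ltnn.
Qed.

Section FreeGroup.
Variable T : choiceType.

(* (x, true) stands for the generator x, and (x, false) for its inverse. *)
Implicit Types (x y : T * bool) (s t u : seq (T * bool)).

Definition flip x : T * bool := (x.1, ~~ x.2).

Definition fg_reduced s : bool := sorted (fun x y => y != flip x) s.

Definition fg_cons x s : seq (T * bool) :=
  if s is y :: s' then if y == flip x then s' else x :: s else [:: x].

Definition fg_mulseq s t : seq (T * bool) := foldr fg_cons t s.

Definition fg_invseq s : seq (T * bool) := rev (map flip s).

Lemma flipK : involutive flip.
Proof. by case=> x b; rewrite /flip /= negbK. Qed.

Lemma fg_cons_reduced x s : fg_reduced s -> fg_reduced (fg_cons x s).
Proof.
case: s => //= y s; case: ifPn => [_|/= -> //].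
exact: path_sorted.
Qed.

Lemma fg_consK x s : fg_reduced s -> fg_cons x (fg_cons (flip x) s) = s.
Proof.
case: s => [|y s] /=; first by rewrite eqxx.
rewrite flipK; case: eqP => [-> {y}|_ _ /=]; last by rewrite eqxx.
by case: s => //= z s /andP[/negbTE ->].
Qed.

Lemma fg_mulseq_reduced s t : fg_reduced t -> fg_reduced (fg_mulseq s t).
Proof. by move=> red_t; elim: s => //= x s; apply: fg_cons_reduced. Qed.

Lemma fg_mulseqs0 s : fg_reduced s -> fg_mulseq s [::] = s.
Proof.
elim: s => //= x s IH red_s; rewrite IH; last exact: path_sorted red_s.
by case: s red_s {IH} => //= y s /andP[/negbTE ->].
Qed.

Lemma fg_mulseq_cons x s t : fg_reduced t ->
  fg_mulseq (fg_cons x s) t = fg_cons x (fg_mulseq s t).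
Proof.
move=> red_t; case: s => //= y s; case: eqP => //= ->.
by rewrite fg_consK // fg_mulseq_reduced.
Qed.

Lemma fg_mulseqA s t u : fg_reduced u ->
  fg_mulseq s (fg_mulseq t u) = fg_mulseq (fg_mulseq s t) u.
Proof. by move=> red_u; elim: s => //= x s ->; rewrite fg_mulseq_cons. Qed.

Lemma fg_invseqK : involutive fg_invseq.
Proof. by move=> s; rewrite /fg_invseq map_rev revK (mapK flipK). Qed.

Lemma fg_mulVseq s : fg_mulseq (fg_invseq s) s = [::].
Proof.
elim: s => //= x s IH; rewrite /fg_invseq /= rev_cons /fg_mulseq foldr_rcons.
by rewrite /= flipK eqxx.
Qed.

Lemma fg_invseq_reduced s : fg_reduced s -> fg_reduced (fg_invseq s).
Proof.
rewrite /fg_reduced /fg_invseq rev_sorted sorted_map; apply: sub_sorted => x y /=.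
by apply: contra => /eqP ->; rewrite flipK.
Qed.

Record free_group := FreeGroup {
  fg_seq :> seq (T * bool);
  fg_seqP : fg_reduced fg_seq }.

HB.instance Definition _ := [isSub for fg_seq].
HB.instance Definition _ := [Choice of free_group by <:].

Definition fg_one := FreeGroup (isT : fg_reduced [::]).
Definition fg_mul (g h : free_group) : free_group :=
  FreeGroup (fg_mulseq_reduced g (fg_seqP h)).
Definition fg_inv (g : free_group) : free_group :=
  FreeGroup (fg_invseq_reduced (fg_seqP g)).

Lemma fg_mulA : associative fg_mul.
Proof. by move=> g h k; apply/val_inj/fg_mulseqA/fg_seqP. Qed.
Lemma fg_mul1 : left_id fg_one fg_mul.
Proof. by move=> g; apply/val_inj. Qed.
Lemma fg_mulr1 : right_id fg_one fg_mul.
Proof. by move=> g; apply/val_inj/fg_mulseqs0/fg_seqP. Qed.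
Lemma fg_mulV : left_inverse fg_one fg_inv fg_mul.
Proof. by move=> g; apply/val_inj/fg_mulVseq. Qed.
Lemma fg_mulrV : right_inverse fg_one fg_inv fg_mul.
Proof.
by move=> g; apply/val_inj; rewrite /= -{1}[fg_seq g]fg_invseqK fg_mulVseq.
Qed.

HB.instance Definition _ :=
  isGroup.Build free_group fg_mulA fg_mul1 fg_mulr1 fg_mulV fg_mulrV.

Definition fg_gen (x : T) : free_group :=
  FreeGroup (isT : fg_reduced [:: (x, true)]).

Definition fg_word (w : seq T) : free_group := (\prod_(x <- w) fg_gen x)%g.

Lemma fg_wordE w : fg_seq (fg_word w) = [seq (z, true) | z <- w].
Proof.
rewrite /fg_word; elim: w => [|x w IH]; first by rewrite big_nil.
by rewrite big_cons /= IH; case: w {IH} => //= y w; rewrite xpair_eqE andbF.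
Qed.

End FreeGroup.

Definition gap w (hw : factorD w) (p : nat) : free_group letter :=
  let n := size w in
  let i := occ_pos hw p in
  let j := occ_pos hw p.+1 in
  if i + n == j then 1%g
  else if i + n < j then fg_word (subword (i + n) (j - (i + n)))
  else ((fg_word (subword j (i + n - j)))^-1)%g.

Definition droplast (T : Type) (s : seq T) : seq T := take (size s).-1 s.

(* Meaningful for m >= 1 and i = 1, 2 only. *)
Definition envelope (m i : nat) : seq letter :=
  if i == 1 then droplast (A m) else A m.-1 ++ droplast (A m).

Definition env_index (m i : nat) : bool := (0 < m) && (i \in [:: 1; 2]).

Definition env_lt (m1 i1 m2 i2 : nat) : bool :=
  (m1 < m2) || ((m1 == m2) && (i1 < i2)).

(* Env(w) = E_{m,i}. Different indices give different words (lemma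
   envelope_size_lt), so the order on words is an order on indices. *)
Definition is_Env (w : seq letter) (m i : nat) : Prop :=
  [/\ env_index m i,
      infix w (envelope m i)
    & forall m' i', env_index m' i' -> env_lt m' i' m i ->
        ~~ infix w (envelope m' i')].

Lemma droplast_fg m :
  fg_word (droplast (A m)) = (fg_word (A m) / fg_gen (last La (A m)))%g.
Proof.
have: 0 < size (A m) by rewrite size_A expn_gt0.
case/lastP: (A m) => // s x _; rewrite /droplast size_rcons /= last_rcons.
rewrite -cats1 take_size_cat // /fg_word big_cat big_seq1 /=.
by rewrite mulgK.
Qed.

Lemma envelope_size_lt m1 i1 m2 i2 : env_index m1 i1 -> env_index m2 i2 ->
  env_lt m1 i1 m2 i2 -> size (envelope m1 i1) < size (envelope m2 i2).
Proof.
case: m1 m2 => [//|m1] [//|m2]; rewrite /env_index /= !inE => i1P i2P lt12.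
have sz m i : size (envelope m.+1 i)
    = (if i == 1 then 2 ^ m.+1 else 2 ^ m + 2 ^ m.+1).-1.
  have: 0 < 2 ^ m by rewrite expn_gt0.
  rewrite /envelope /droplast; case: (i == 1);
    rewrite ?size_cat size_takel !size_A expnS //=; lia.
have pos : 0 < 2 ^ m1 by rewrite expn_gt0.
rewrite !sz; case/orP: lt12 => [lt12|/andP[/eqP[<-] lt12]]; last first.
  have ->: i1 = 1 by case/orP: i1P lt12 i2P => /eqP-> //; lia.
  have ->: i2 = 2 by case/orP: i1P lt12 i2P => /eqP-> //; lia.
  by rewrite /= expnS; lia.
have le12 : 2 ^ m1.+1 <= 2 ^ m2 by rewrite leq_exp2l.
by move: le12; rewrite !expnS; case: eqP => _; case: eqP => _; lia.
Qed.

Lemma is_Env_exists w : factorD w -> exists m i, is_Env w m i.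
Proof.
move=> [k /eqP occ_k]; pose n := k + size w.
have w_n1 : infix w (envelope n.+1 1).
  have lt_n : n < 2 ^ n by exact: ltn_expl.
  apply/infixP; exists (mkseq Dinf k), (drop n (droplast (A n.+1))).
  have ->: mkseq Dinf k ++ w ++ drop n (droplast (A n.+1))
      = mkseq Dinf n ++ drop n (droplast (A n.+1)).
    rewrite catA; congr (_ ++ _); rewrite -[X in _ ++ X]occ_k /subword /mkseq.
    by rewrite -map_cat /n iotaD.
  rewrite /envelope /= -[LHS](cat_take_drop n); congr (_ ++ _).
  have lt_n1 : n <= (2 ^ n.+1).-1 by rewrite expnS; lia.
  have sz : size (droplast (A n.+1)) = (2 ^ n.+1).-1.
    by rewrite size_takel size_A // leq_pred.
  apply: (@eq_from_nth _ La).
    by rewrite size_map size_iota size_takel // sz.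
  move=> r; rewrite size_takel ?sz // => lt_r.
  rewrite (nth_map 0) ?size_iota // nth_iota // add0n nth_take //.
  rewrite -[morph sigma (A n)]/(A n.+1) nth_take ?size_A; first last.
    exact: leq_trans lt_r lt_n1.
  by rewrite -Dinf_prefix //; apply: leq_trans lt_r (leq_trans lt_n1 (leq_pred _)).
pose P c := [&& 0 < c./2 & infix w (envelope c./2 (odd c).+1)].
have exP : exists c, P c.
  by exists n.+1.*2; rewrite /P odd_double doubleK w_n1.
case: (ex_minnP exP) => c /andP[c_gt0 w_c] min_c.
exists c./2, (odd c).+1; split=> //.
  by rewrite /env_index c_gt0; case: (odd c).
move=> m' i' /andP[m'_gt0]; rewrite !inE => i'P lt_mi; apply/negP => w_i'.
have: P (i'.-1 + m'.*2).
  by rewrite /P; case/orP: i'P w_i' => /eqP-> /=;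
    rewrite ?add1n ?add0n /= ?odd_double ?uphalf_double ?doubleK m'_gt0.
move/min_c; rewrite -{1}[c]odd_double_half.
by move: lt_mi i'P; rewrite /env_lt; case: (odd c); lia.
Qed.

Definition phi1 (x : letter) : seq letter :=
  match x with La => [:: La] | Lb => [:: Lb; Lb] end.

Definition phi2 (x : letter) : seq letter3 :=
  match x with La => [:: Ta; Tb] | Lb => [:: Ta; Tc; Ta; Tc] end.

Definition Theta1 : nat -> letter := inf_image La phi1 Dinf.

Definition Theta2 : nat -> letter3 := inf_image Ta phi2 Dinf.

(* Main.v *)
(** Every factor [w] other than the factors of [aa] has all its occurrences at
    positions of the same parity, hence it has a smallest extension of the form
    [sigma(w') a] and its occurrences are those of [w'], doubled and shifted.
    As E_{m+1,i} = sigma(E_{m,i}) a, iterating reduces the envelope of [w] to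
    E_{1,1} = a or E_{1,2} = aa: the occurrences of [w] are the images of those
    of [a^i] under an affine map [P |-> 2^(m-1) P + o].  The letter D_k = a, b
    contributes to [sigma(D)] one or two occurrences of [a], and to
    [sigma^3(D)] two or four occurrences of [aa]; the words lying between
    consecutive ones are coded by phi_1(D_k), respectively phi_2(D_k). *)
Require Import Defs.
From mathcomp Require Import all_boot.
From mathcomp Require Import zify.

Set Implicit Arguments.
Unset Strict Implicit.
Unset Printing Implicit Defensive.

(** * Occurrences of words in [Dinf] *)

Lemma occP w x :
  reflect (forall r, r < size w -> Dinf (x + r) = nth La w r) (occ w x).
Proof.
apply: (iffP eqP) => [<- r|H].
  rewrite size_map size_iota => lt_r.
  by rewrite (nth_map 0) ?size_iota // nth_iota.
apply: (@eq_from_nth _ La); rewrite size_map size_iota // => r lt_r.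
by rewrite (nth_map 0) ?size_iota // nth_iota // H.
Qed.

Lemma occ_subword x n : occ (subword x n) x.
Proof. by rewrite /occ size_map size_iota. Qed.

Lemma occ_cat u v x : occ (u ++ v) x = occ u x && occ v (x + size u).
Proof.
rewrite /occ size_cat /subword iotaD map_cat eqseq_cat //.
by rewrite size_map size_iota.
Qed.

Lemma occ_cons a u x : occ (a :: u) x = (Dinf x == a) && occ u x.+1.
Proof. by rewrite /occ /subword /= eqseq_cons. Qed.

(** Inside an occurrence of a known word, testing for [v] becomes a comparison of finite words,
    which later proofs settle by computation. *)
Lemma occ_sub u v x t :
  occ u x -> t + size v <= size u ->
  occ v (x + t) = (take (size v) (drop t u) == v).
Proof.
move=> occ_u le_tv; have sz : size (take (size v) (drop t u)) = size v.
  by rewrite size_takel // size_drop; lia.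
set v' := take _ _ in sz *.
have uE : u = take t u ++ v' ++ drop (size v) (drop t u) by rewrite !cat_take_drop.
move: occ_u; rewrite uE !occ_cat size_takel; last by lia.
by case/and3P=> _; rewrite /occ sz => /eqP-> _.
Qed.

Lemma infix_occ u v x t :
  occ u x -> occ v (x + t) -> t + size v <= size u -> infix v u.
Proof.
move=> occ_u occ_v le_tv; move: occ_v; rewrite (occ_sub occ_u) // => /eqP <-.
exact: infix_trans (infix_take _ _) (infix_drop _ _).
Qed.

(** * Self-similarity of [Dinf] under doubling of positions *)

Lemma Dinf_even n : Dinf n.*2 = La.
Proof. by case: (Dinf_double n). Qed.

Lemma Dinf_odd n : Dinf n.*2.+1 = if Dinf n is La then Lb else La.
Proof. by case: (Dinf_double n) => _ ->; case: (Dinf n). Qed.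

Lemma Dinf_odd_inj m n : Dinf m.*2.+1 = Dinf n.*2.+1 -> Dinf m = Dinf n.
Proof. by rewrite !Dinf_odd; case: (Dinf m); case: (Dinf n). Qed.

(** Odd positions are governed by the agreeing letters, and even positions always carry a; the
    latter yields the extra position [r = L.*2]. *)
Lemma Dinf_agree_double P Q L :
  (forall r, r < L -> Dinf (P + r) = Dinf (Q + r)) ->
  forall r, r <= L.*2 -> Dinf (P.*2 + r) = Dinf (Q.*2 + r).
Proof.
move=> agree r le_r.
have E X : X.*2 + r = odd r + (X + r./2).*2 by lia.
rewrite !E; case: (boolP (odd r)) => odd_r; last by rewrite !Dinf_even.
by rewrite !add1n !Dinf_odd agree //; lia.
Qed.

(** Agreement on L letters becomes agreement on 2L + 1 letters after one doubling, so the length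
    plus one doubles at each step. *)
Lemma Dinf_agree_expn k P Q L :
  (forall r, r < L -> Dinf (P + r) = Dinf (Q + r)) ->
  forall r, r.+1 < 2 ^ k * L.+1 -> Dinf (2 ^ k * P + r) = Dinf (2 ^ k * Q + r).
Proof.
move=> agree; elim: k => [|k IH] r.
  by rewrite expn0 !mul1n ltnS; apply: agree.
rewrite expnS -!mulnA !mul2n => lt_r.
apply: (@Dinf_agree_double _ _ (2 ^ k * L.+1).-1); last by lia.
by move=> s lt_s; apply: IH; lia.
Qed.

(** * Action of sigma on occurrences and envelope words *)

Lemma morph_cons (S T : Type) (f : S -> seq T) a s :
  morph f (a :: s) = f a ++ morph f s.
Proof. by []. Qed.

(** The extra [La] begins the image of the letter following [u]: both images under sigma start with
    a. *)
Lemma occ_sigma u x : occ u x -> occ (morph sigma u ++ [:: La]) x.*2.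
Proof.
elim: u x => [|a u IH] x; first by rewrite occ_cons Dinf_even.
rewrite occ_cons => /andP[/eqP D_x /IH occ_u].
rewrite morph_cons -catA occ_cat; apply/andP; split.
  by case: a D_x => D_x; rewrite !occ_cons Dinf_even Dinf_odd D_x.
by rewrite (_ : size (sigma a) = 2) ?addn2 //; case: a {D_x}.
Qed.

Lemma infix_sigma u v :
  infix u v -> infix (morph sigma u ++ [:: La]) (morph sigma v ++ [:: La]).
Proof.
case/infixP=> p [s ->]; rewrite !morph_cat -!catA; apply: infix_catl.
(* If [s] is nonempty, its image starts with a, which absorbs the final [La]. *)
by apply/prefixW; rewrite prefix_catr // eqxx; case: s => [|[] s]; rewrite ?prefix0s.
Qed.

Lemma droplast_A m :
  droplast (A m.+1) = morph sigma (droplast (A m)) ++ [:: La].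
Proof.
have: 0 < size (A m) by rewrite size_A expn_gt0.
rewrite /A iterS -/(A m); case/lastP: (A m) => // s x _.
have -> : droplast (rcons s x) = s.
  by rewrite /droplast size_rcons -cats1 take_size_cat.
rewrite /droplast -cats1 morph_cat.
have -> : morph sigma [:: x] = [:: La] ++ [:: nth La (sigma x) 1] by case: x.
by rewrite catA take_size_cat // !size_cat !addn1.
Qed.

Lemma envelope_sigma m i :
  envelope m.+2 i = morph sigma (envelope m.+1 i) ++ [:: La].
Proof.
rewrite /envelope; case: (i == 1); rewrite droplast_A //.
by rewrite morph_cat catA.
Qed.

Lemma occ_envelope m i : env_index m i -> exists x, occ (envelope m i) x.
Proof.
case: m => // m; rewrite /env_index !inE /= => i12; elim: m => [|m [x /occ_sigma]].
  (* [Dinf] begins with abaa: E_{1,1} = a occurs at 0 and E_{1,2} = aa at 2. *)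
  by case/orP: i12 => /eqP->; [exists 0|exists 2].
by rewrite -envelope_sigma; exists x.*2.
Qed.

(** * Desubstitution of factors, down to a and aa *)

Lemma occ_parity w x y :
  ~~ infix w [:: La; La] -> occ w x -> occ w y -> odd x = odd y.
Proof.
move=> w_aa; wlog ox : x y / odd x => [wl occ_x occ_y|/occP occ_x /occP occ_y].
  case ox: (odd x); first by rewrite -ox; apply: wl.
  by case oy: (odd y) => //; rewrite -ox -oy; apply/esym/wl.
rewrite ox; case oy: (odd y) => //; exfalso.
(* Each letter of [w] falls on an even position in one of the two occurrences, hence is a. *)
have w_a : w = nseq (size w) La.
  apply: (@eq_from_nth _ La); rewrite ?size_nseq // => r lt_r.
  rewrite nth_nseq lt_r; case or: (odd r).
    by rewrite -occ_x // (_ : x + r = (x + r)./2.*2) ?Dinf_even //; lia.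
  by rewrite -occ_y // (_ : y + r = (y + r)./2.*2) ?Dinf_even //; lia.
have gt2 : 2 < size w.
  rewrite ltnNge; apply: contra w_aa.
  by rewrite w_a size_nseq; case: (size w) => [|[|[|n]]].
have D r : r < 3 -> Dinf (x + r) = La.
  move=> lt_r; have lt_w := leq_trans lt_r gt2.
  by rewrite occ_x // w_a nth_nseq lt_w.
(* With n = [x./2], the letter a at 2n + 1 and 2n + 3 forces D_n = D_{n+1} = b, although n or n + 1
   is even. *)
have := D 0 isT; have := D 2 isT.
have -> : x + 2 = x./2.+1.*2.+1 by lia.
have -> : x + 0 = x./2.*2.+1 by lia.
rewrite !Dinf_odd; case ok: (odd x./2).
  by have -> : x./2.+1 = x./2.+1./2.*2; [lia | rewrite Dinf_even].
by have -> : x./2 = x./2./2.*2; [lia | rewrite Dinf_even].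
Qed.

(** The odd positions 2t + 1 covered by [w] at [s] are those with [s./2 <= t < (s + size w)./2];
    they encode the letters D_t, while even positions always carry a. *)
Lemma occ_half w s x :
  occ w s -> odd x = odd s ->
  occ w x = occ (subword s./2 ((s + size w)./2 - s./2)) x./2.
Proof.
move=> /occP occ_s ox; have /occP occ_s' := occ_subword s./2 ((s + size w)./2 - s./2).
rewrite size_map size_iota in occ_s'.
have [Ex Es] := (odd_double_half x, odd_double_half s).
apply/occP/occP; rewrite ?size_map ?size_iota => occ_x r lt_r.
  rewrite -occ_s' //; apply: Dinf_odd_inj.
  have lt_r' : r.*2.+1 - odd s < size w by lia.
  have := occ_x _ lt_r'; rewrite -occ_s //.
  rewrite (_ : x + _ = (x./2 + r).*2.+1); last by lia.
  by rewrite (_ : s + _ = (s./2 + r).*2.+1) //; lia.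
rewrite -occ_s //.
have E X : odd X = odd s -> X + r = X./2.*2 + (odd s + r) by lia.
rewrite (E x) // (E s) //.
apply: (@Dinf_agree_double _ _ ((s + size w)./2 - s./2)); last by lia.
by move=> t lt_t; rewrite occ_x // occ_s'.
Qed.

(** The bound on [o] keeps [w] within the letters forced by an occurrence of a^i after k doublings,
    as measured by [Dinf_agree_expn]. *)
Lemma occ_affine w m i :
  w <> [::] -> is_Env w m i ->
  exists k o, o + size w < 2 ^ k * i.+1 /\
    forall x, occ w x <-> exists2 P, occ (nseq i La) P & x = 2 ^ k * P + o.
Proof.
case: m => [|m]; first by move=> _ [].
elim: m w => [|m IH] w w0 [mi w_mi min_mi].
  exists 0, 0; rewrite expn0 mul1n.
  (* A nonempty factor of E_{1,1} = a is a; a factor of E_{1,2} = aa that is not one of a is aa. *)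
  have wE : w = nseq i La.
    case/andP: mi w_mi min_mi => _; rewrite !inE => /orP[] /eqP-> w_mi min_mi.
      by move: w_mi w0 {min_mi}; case: w => [|[] [|b w]].
    have := min_mi 1 1 isT isT; move: w_mi w0 {min_mi}.
    by case: w => [|[] [|[] [|c w]]].
  split; first by rewrite add0n wE size_nseq.
  move=> x; rewrite wE; split; first by exists x => //; lia.
  by case=> P occ_P ->; rewrite mul1n addn0.
have w_aa : ~~ infix w [:: La; La] by apply: (min_mi 1 2).
have w_a : ~~ infix w [:: La] by apply: (min_mi 1 1).
have mi1 : env_index m.+1 i by case/andP: mi.
have [Q occ_Q] := occ_envelope mi1.
have := occ_sigma occ_Q; rewrite -envelope_sigma.
case/infixP: w_mi => p [q E_mi]; rewrite E_mi !occ_cat => /and3P[_ occ_s _].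
set s := Q.*2 + size p in occ_s.
set n' := (s + size w)./2 - s./2; set w' := subword s./2 n'.
have sz_w' : size w' = n' by rewrite size_map size_iota.
have sz_mi : size p + size w <= (size (envelope m.+1 i)).*2.+1.
  have := f_equal size E_mi.
  by rewrite envelope_sigma !size_cat size_morph_sigma /=; lia.
have occ_w' : occ w' s./2 by apply: occ_subword.
have Es := odd_double_half s.
have w_w' : infix w (morph sigma w' ++ [:: La]).
  apply: (infix_occ (t := odd s) (occ_sigma occ_w')).
    by rewrite addnC Es.
  by rewrite size_cat size_morph_sigma sz_w' /=; lia.
have w'0 : w' <> [::] by move=> w'0; move: w_w' w_a; rewrite w'0 => ->.
have Env_w' : is_Env w' m.+1 i.
  split=> //.
    apply: (infix_occ (t := s./2 - Q) occ_Q).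
      by rewrite subnKC // /s; clear; lia.
    by rewrite sz_w' /n' /s; move: sz_mi; clear; lia.
  (* An earlier envelope of [w'] would, under sigma, give an earlier envelope containing [w]. *)
  move=> [//|m'] i' mi' lt_mi; apply/negP => /infix_sigma; rewrite -envelope_sigma.
  move/(infix_trans w_w'); apply/negP; apply: min_mi => //.
have [k [o [le_o occ_x]]] := IH _ w'0 Env_w'.
exists k.+1, (odd s + o.*2); split.
  by rewrite expnS -mulnA mul2n; move: le_o Es; rewrite sz_w'; clear; lia.
move=> x; rewrite expnS; split.
  move=> occ_wx; have ox := occ_parity w_aa occ_wx occ_s.
  move: occ_wx; rewrite (occ_half occ_s ox) => /occ_x[P occ_P Ex].
  by exists P => //; rewrite -[x]odd_double_half Ex ox -mulnA mul2n doubleD addnCA.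
case=> P occ_P Ex.
have Ex' : x = odd s + (2 ^ k * P + o).*2 by rewrite Ex -mulnA mul2n doubleD addnCA.
have ox : odd x = odd s by rewrite Ex' oddD odd_double addbF; case: (odd s).
rewrite (occ_half occ_s ox); apply/occ_x; exists P => //.
by rewrite Ex' half_bit_double.
Qed.

(** * Gaps as functions of local windows, and next occurrences *)

Lemma gap_congr w (hw : factorD w) p q L :
  occ_pos hw p.+1 = occ_pos hw p + L -> occ_pos hw q.+1 = occ_pos hw q + L ->
  (forall r, r < L + size w -> Dinf (occ_pos hw p + r) = Dinf (occ_pos hw q + r)) ->
  gap hw p = gap hw q.
Proof.
rewrite /gap => -> -> agree; set x := occ_pos hw p; set y := occ_pos hw q.
have subE s n : s + n <= L + size w -> subword (x + s) n = subword (y + s) n.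
  move=> le_n; rewrite /subword !iotaDl -!map_comp; apply/eq_in_map => r.
  rewrite mem_iota => /andP[_ lt_r] /=.
  by apply: agree; lia.
(* Both gaps fall in the same case, decided by comparing [size w] with [L]. *)
rewrite !eqn_add2l !ltn_add2l !subnDl.
case: eqP => // _; case: ltnP => lt_L; first by rewrite subE //; lia.
by rewrite subE //; lia.
Qed.

Lemma next_occE w (hw : factorD w) N x :
  N <= x -> occ w x -> (forall y, N <= y < x -> ~~ occ w y) -> next_occ hw N = x.
Proof.
move=> le_x occ_x no_occ; have [le_N occ_N min_N] := next_occP hw N.
apply/eqP; rewrite eqn_leq min_N //= leqNgt; apply/negP => lt_x.
by have := no_occ _ (introT andP (conj le_N lt_x)); rewrite occ_N.
Qed.

(** * Letters of morphic images, and return words *)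

Definition image_index (S T : Type) (f : S -> seq T) (x : nat -> S) p k j :=
  p = size (morph f (mkseq x k)) + j /\ j < size (f (x k)).


Lemma mkseqD (T : Type) (x : nat -> T) m n :
  mkseq x (m + n) = mkseq x m ++ [seq x k | k <- iota m n].
Proof. by rewrite /mkseq iotaD map_cat. Qed.

Lemma size_morph_mkseqS (S T : Type) (f : S -> seq T) (x : nat -> S) k :
  size (morph f (mkseq x k.+1)) = size (morph f (mkseq x k)) + size (f (x k)).
Proof. by rewrite -addn1 mkseqD morph_cat size_cat /morph /= cats0. Qed.

Lemma inf_imageE (S T : Type) (d : T) (f : S -> seq T) (x : nat -> S) p k j :
  (forall a, 0 < size (f a)) -> image_index f x p k j ->
  inf_image d f x p = nth d (f (x k)) j.
Proof.
(* Blocks are nonempty, so block k lies within the first p + 1 blocks, those that [inf_image]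
   reads. *)
move=> f0 [p_kj lt_j]; have le_kp : k <= p.
  rewrite p_kj; apply: leq_trans (leq_addr _ _).
  elim: (k) => // n IH; rewrite size_morph_mkseqS.
  by have := f0 (x n); lia.
rewrite /inf_image -(subnKC (le_kp : k.+1 <= p.+1)) mkseqD morph_cat nth_cat.
rewrite size_morph_mkseqS {1}p_kj ltn_add2l lt_j.
rewrite -addn1 mkseqD morph_cat nth_cat /morph /= cats0 -/(morph f _).
by rewrite p_kj ltnNge leq_addr /= addKn.
Qed.

Lemma image_index_next (S T : Type) (f : S -> seq T) (x : nat -> S) p k j :
  (forall a, 0 < size (f a)) -> image_index f x p k j ->
  if j.+1 < size (f (x k)) then image_index f x p.+1 k j.+1
  else image_index f x p.+1 k.+1 0.
Proof.
move=> f0 [-> lt_j]; case: ltnP => le_j; split => //; first by rewrite addnS.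
by rewrite size_morph_mkseqS; lia.
Qed.

(** Complete return words: when [u] occurs at P, the first occurrence of [e] after P is the one
    ending [u]. *)
Definition return_word (e u : seq letter) :=
  [&& size e < size u, drop (size u - size e) u == e
    & all (fun r => take (size e) (drop r u) != e)
        (iota 1 (size u - size e).-1)].

(** * Enumeration of the occurrences of [w] by coded return words *)

Section Enumeration.

Variables (w : seq letter) (hw : factorD w) (e : seq letter) (c o : nat).
Hypothesis c_gt0 : 0 < c.
Hypothesis occ_we : forall x, occ w x <-> exists2 P, occ e P & x = c * P + o.

Lemma next_occ_affine N P :
  N <= c * P + o -> occ e P ->
  (forall R, N <= c * R + o -> R < P -> ~~ occ e R) ->
  next_occ hw N = c * P + o.
Proof.
move=> le_N occ_P no_occ; apply: next_occE => //; first by apply/occ_we; exists P.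
move=> y /andP[le_y lt_y]; apply/negP => /occ_we[R occ_R y_R].
move: le_y lt_y; rewrite y_R ltn_add2r ltn_pmul2l // => le_y lt_R.
by have := no_occ R le_y lt_R; rewrite occ_R.
Qed.

Lemma next_occ_return u P : return_word e u -> occ u P ->
  next_occ hw (c * P + o).+1 = c * (P + (size u - size e)) + o.
Proof.
case/and3P=> lt_eu /eqP end_u /allP no_u occ_u; apply: next_occ_affine.
- by rewrite ltn_add2r ltn_pmul2l //; lia.
- by rewrite (occ_sub occ_u) ?end_u ?take_size ?subnK // ltnW.
move=> R; rewrite ltn_add2r ltn_pmul2l // => lt_P lt_R.
rewrite -(subnKC (ltnW lt_P)) (occ_sub occ_u); last by lia.
by apply: no_u; rewrite mem_iota; lia.
Qed.

(** Each D_k inflates to a block of length [L]; its j-th occurrence of [e] (from 0) is at [off j]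
    and starts the return word coded by the j-th letter of f(D_k). *)
Variables (T : Type) (d : T) (f : letter -> seq T) (win : T -> seq letter).
Variables (L : nat) (off : nat -> nat).
Hypothesis f_gt0 : forall a, 0 < size (f a).
Hypothesis win_return : forall t, return_word e (win t).
Hypothesis occ_off0 : occ e (off 0).
Hypothesis occ_off0_min : forall R, R < off 0 -> ~~ occ e R.
Hypothesis occ_win : forall k j, j < size (f (Dinf k)) ->
  occ (win (nth d (f (Dinf k)) j)) (L * k + off j).
Hypothesis size_win : forall a j, j < size (f a) ->
  off j + (size (win (nth d (f a) j)) - size e) =
  if j.+1 < size (f a) then off j.+1 else L + off 0.

Lemma occ_pos_enum p : exists P,
  let u := win (inf_image d f Dinf p) in
  [/\ occ u P, occ_pos hw p.+1 = c * P + o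
    & occ_pos hw p.+2 = c * (P + (size u - size e)) + o].
Proof.
have enum q : exists k j, image_index f Dinf q k j /\
    occ_pos hw q.+1 = c * (L * k + off j) + o.
  elim: q => [|q [k [j [q_kj pos_q]]]].
    exists 0, 0; split; first by split.
    by rewrite muln0 add0n; apply: next_occ_affine => // R _; apply: occ_off0_min.
  have [_ lt_j] := q_kj; have := image_index_next f_gt0 q_kj.
  have pos_q1 : occ_pos hw q.+2 = c * (L * k +
      if j.+1 < size (f (Dinf k)) then off j.+1 else L + off 0) + o.
    rewrite -size_win // addnA -(next_occ_return (win_return _) (occ_win lt_j)).
    by rewrite -pos_q.
  case: ifP pos_q1 => _ pos_q1 q1; first by exists k, j.+1.
  by exists k.+1, 0; rewrite mulnSr -addnA.
have [k [j [p_kj pos_p]]] := enum p; have [_ lt_j] := p_kj.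
exists (L * k + off j) => /=; rewrite (inf_imageE d f_gt0 p_kj).
have occ_u := occ_win lt_j; split=> //.
by rewrite -(next_occ_return (win_return _) occ_u) -pos_p.
Qed.

End Enumeration.

(** Equal windows [u] force agreement on 2^k (|u| + 1) - 1 letters; the gap reads o + 2^k (|u| - i)
    + |w| of them at most, which [le_o] makes small enough. *)
Lemma gap_enum w (hw : factorD w) k o i (T : Type) (th : nat -> T)
    (win : T -> seq letter) :
  o + size w < 2 ^ k * i.+1 -> (forall t, i < size (win t)) ->
  (forall p, exists P,
     let u := win (th p) in
     [/\ occ u P, occ_pos hw p.+1 = 2 ^ k * P + o
       & occ_pos hw p.+2 = 2 ^ k * (P + (size u - i)) + o]) ->
  forall p q, th p = th q -> gap hw p.+1 = gap hw q.+1.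
Proof.
move=> le_o lt_i enum p q th_pq; have [P] := enum p; have [Q] := enum q.
rewrite /= th_pq; set u := win _ => -[/occP occ_Q q1 q2] [/occP occ_P p1 p2].
apply: (@gap_congr _ _ _ _ (2 ^ k * (size u - i))).
- by rewrite p1 p2 mulnDr addnAC.
- by rewrite q1 q2 mulnDr addnAC.
move=> r lt_r; rewrite p1 q1 -!addnA.
apply: (@Dinf_agree_expn _ _ _ (size u)) => [s lt_s|].
  by rewrite occ_P ?occ_Q.
have -> : (size u).+1 = size u - i + i.+1 by have := lt_i (th q); rewrite -/u; lia.
by rewrite mulnDr; lia.
Qed.

(** * Return words to a and to aa, and the conclusion *)

Definition win1 (t : letter) : seq letter :=
  match t with La => [:: La; Lb; La] | Lb => [:: La; La] end.

(** Read off sigma^3(a) = abaaabab and sigma^3(b) = abaaabaa, each followed by abaa: aa starts at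
    offsets 2, 3 in the former and 2, 3, 6, 7 in the latter. *)
Definition win2 (t : letter3) : seq letter :=
  match t with
  | Ta => [:: La; La; La]
  | Tb => [:: La; La; Lb; La; Lb; La; Lb; La; La]
  | Tc => [:: La; La; Lb; La; La]
  end.

(** Windows overrun their block, so two consecutive letters are inflated together. *)
Lemma occ_Dinf2 k : occ [:: Dinf k; Dinf k.+1] k.
Proof. by rewrite !occ_cons !eqxx. Qed.

Lemma occ_win1 k j : j < size (phi1 (Dinf k)) ->
  occ (win1 (nth La (phi1 (Dinf k)) j)) (2 * k + j).
Proof.
have := occ_sigma (occ_Dinf2 k); rewrite mul2n.
case: (Dinf k) => occ_u; case: (Dinf k.+1) occ_u => occ_u;
  by case: j => [|[|j]] // _; rewrite (occ_sub occ_u).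
Qed.

Lemma occ_win2 k j : j < size (phi2 (Dinf k)) ->
  occ (win2 (nth Ta (phi2 (Dinf k)) j)) (8 * k + nth 0 [:: 2; 3; 6; 7] j).
Proof.
have := occ_sigma (occ_sigma (occ_sigma (occ_Dinf2 k))).
have -> : 8 * k = k.*2.*2.*2 by lia.
case: (Dinf k) => occ_u; case: (Dinf k.+1) occ_u => occ_u;
  by case: j => [|[|[|[|j]]]] // _; rewrite (occ_sub occ_u).
Qed.

Theorem theorem5p2 (w : seq letter) (hw : factorD w) (m i : nat)
    (w_nonempty : w <> [::]) (hEnv : is_Env w m i) :
  (i = 1 -> forall p : nat, 1 <= p ->
     gap hw p = match Theta1 p.-1 with
                | La => gap hw 1
                | Lb => gap hw 2
                end) /\
  (i = 2 -> forall p : nat, 1 <= p ->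
     gap hw p = match Theta2 p.-1 with
                | Ta => gap hw 1
                | Tb => gap hw 2
                | Tc => gap hw 4
                end).
Proof.
have [k [o [le_o occ_w]]] := occ_affine w_nonempty hEnv.
have c_gt0 : 0 < 2 ^ k by rewrite expn_gt0.
split=> i12 [//|p] _ /=; subst i.
  have same_gap : forall p q, Theta1 p = Theta1 q -> gap hw p.+1 = gap hw q.+1.
    apply: (gap_enum (win := win1) le_o) => [[]//|].
    apply: (occ_pos_enum (L := 2) (off := id) hw c_gt0 occ_w) => //.
    - by case.
    - by case.
    - exact: occ_win1.
    - by case=> [] [|[|j]].
  (* [Theta1] begins with abb: indices 0 and 1 represent its two letters. *)
  by case th_p: (Theta1 p); [apply: (same_gap p 0) | apply: (same_gap p 1)].
have same_gap : forall p q, Theta2 p = Theta2 q -> gap hw p.+1 = gap hw q.+1.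
  apply: (gap_enum (win := win2) le_o) => [[]//|].
  apply: (occ_pos_enum (L := 8) (off := nth 0 [:: 2; 3; 6; 7]) hw c_gt0 occ_w) => //.
  - by case.
  - by case.
  - by case=> [|[|R]].
  - exact: occ_win2.
  - by case=> [] [|[|[|[|j]]]].
(* [Theta2] begins with abac: c first appears at index 3, hence the fourth gap. *)
case th_p: (Theta2 p);
  by [apply: (same_gap p 0) | apply: (same_gap p 1) | apply: (same_gap p 3)].
Qed.
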